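(* Let $\Gamma$ be a weighted digraph with Kirchhoff matrix $L$, let $\tau>0$, and consider any Markov chain related to $\Gamma$, i.e. any homogeneous Markov chain on $\{1,\dots,n\}$ whose transition probability matrix is $P=I-\alpha L$ for some $\alpha>0$. Put $$q=\left(\frac{\tau}{\alpha}+1\right)^{-1}.$$ Then $$Q(\tau)=\widetilde P(\alpha,q),$$ where $Q(\tau)=(I+\tau L)^{-1}$ is the normalized matrix of out forests and $\widetilde P(\alpha,q)$ is the transition matrix of the chain in the geometric model of random observation with success probability $q$.
   Context: $\Gamma$ is a weighted digraph without loops with vertex set $V(\Gamma)=\{1,\dots,n\}$, $n>1$; all arcs have strictly positive real weights; $\varepsilon_{ij}$ denotes the weight of the arc from $i$ to $j$, with $\varepsilon_{ij}=0$ if and only if there is no such arc. The Kirchhoff matrix $L=L(\Gamma)=(\ell_{ij})$ is the $n\times n$ matrix with $\ell_{ij}=-\varepsilon_{ji}$ for $j\ne i$ and $\ell_{ii}=-\sum_{k\ne i}\ell_{ik}$. For $\tau>0$, $I+\tau L$ is invertible, and $Q(\tau)=(I+\tau L)^{-1}$ is called the normalized matrix of out forests. A homogeneous Markov chain with states $\{1,\dots,n\}$ and (row-stochastic) transition probability matrix $P$, whose $(i,j)$ entry is the probability of going from $i$ to $j$, is related to $\Gamma$ if $P=I-\alpha L(\Gamma)$ for some $\alpha\neq 0$. Geometric model of random observation with success probability $q\in(0,1)$: independently of the chain, Bernoulli trials with success probability $q$ are performed at times $t=0,1,2,\dots$ until the first success; the time $T$ of the first success is the epoch of observation, so that $\Pr(T=k)=q(1-q)^k$,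 $k=0,1,2,\dots$. The matrix $\widetilde P(\alpha,q)=(\widetilde p_{ij}(\alpha,q))$ is the matrix of unconditional transition probabilities from the initial state (at $t=0$) to the state at the random epoch $T$: $\widetilde p_{ij}(\alpha,q)$ is the probability that the chain started in state $i$ is in state $j$ at time $T$. *)

(* Defs.v *)
From HB Require Import structures.
From mathcomp Require Import all_boot all_order all_algebra.
From mathcomp Require Import all_classical all_reals all_analysis.
Set Implicit Arguments.
Unset Strict Implicit.
Unset Printing Implicit Defensive.
Import Order.TTheory GRing.Theory Num.Theory.
Local Open Scope classical_set_scope.
Local Open Scope ring_scope.

Record wdigraph (R : realType) (n : nat) := WDigraph {
  arc : rel 'I_n;
  weight : 'I_n -> 'I_n -> R;
  arc_irrefl : forall i, ~~ arc i i;
  weight_gt0 : forall i j, arc i j -> 0 < weight i j;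
  weight_eq0 : forall i j, ~~ arc i j -> weight i j = 0 }.

(* Off the diagonal, entry (i, j) comes from the arc from j to i. *)
Definition kirchhoff_offdiag (R : realType) (n : nat) (G : wdigraph R n)
    (i j : 'I_n) : R :=
  - weight G j i.

Definition kirchhoff (R : realType) (n : nat) (G : wdigraph R n) : 'M[R]_n :=
  \matrix_(i < n, j < n)
    if i == j then - \sum_(k < n | k != i) kirchhoff_offdiag G i k
    else kirchhoff_offdiag G i j.

(* [invmx] is the genuine inverse here when [0 <= tau]: see
   [out_forest_unitmx] below. *)
Definition out_forest (R : realType) (n : nat) (G : wdigraph R n) (tau : R) :
    'M[R]_n :=
  invmx (1%:M + tau *: kirchhoff G).

Definition row_stochastic (R : realType) (n : nat) (P : 'M[R]_n) : Prop :=
  (forall i j, 0 <= P i j) /\ (forall i, \sum_(j < n) P i j = 1).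

Definition prb (R : realType) (d : measure_display) (Omega : measurableType d)
    (Pr : probability Omega R) (A : set Omega) : R :=
  fine (Pr A).

(* Only meaningful when [prb Pr B != 0]. *)
Definition cond_prb (R : realType) (d : measure_display)
    (Omega : measurableType d) (Pr : probability Omega R) (A B : set Omega) :
    R :=
  prb Pr (A `&` B) / prb Pr B.

(* Every subset of the (finite) value space is considered measurable. *)
Definition discrete_process (d : measure_display) (Omega : measurableType d)
    (T : Type) (Y : nat -> Omega -> T) : Prop :=
  forall (k : nat) (D : set T), measurable (Y k @^-1` D).

Definition process_sigma (Omega T : Type) (Y : nat -> Omega -> T) :
    set (set Omega) :=
  <<s [set A | exists (k : nat) (D : set T), A = Y k @^-1` D] >>.

Definition independent_processes (R : realType) (d : measure_display)
    (Omega : measurableType d) (Pr : probability Omega R) (T U : Type)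
    (Y : nat -> Omega -> T) (Z : nat -> Omega -> U) : Prop :=
  forall A B : set Omega, process_sigma Y A -> process_sigma Z B ->
    prb Pr (A `&` B) = prb Pr A * prb Pr B.

(* Time-homogeneous chain with transition matrix [P], started in state [i0]. *)
Record markov_chain (R : realType) (n : nat) (P : 'M[R]_n) (i0 : 'I_n)
    (d : measure_display) (Omega : measurableType d) (Pr : probability Omega R)
    (X : nat -> Omega -> 'I_n) : Prop := MarkovChain {
  chain_measurable : discrete_process X;
  chain_start : prb Pr [set w | X 0%N w = i0] = 1;
  chain_step : forall (k : nat) (x : nat -> 'I_n) (j : 'I_n),
    let past := [set w | forall l : nat, (l <= k)%N -> X l w = x l] in
    prb Pr past != 0 ->
    cond_prb Pr [set w | X k.+1 w = j] past = P (x k) j }.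

Record bernoulli_trials (R : realType) (q : R) (d : measure_display)
    (Omega : measurableType d) (Pr : probability Omega R)
    (B : nat -> Omega -> bool) : Prop := BernoulliTrials {
  trials_measurable : discrete_process B;
  trials_success : forall k : nat, prb Pr [set w | B k w = true] = q;
  trials_indep : forall (s : seq nat) (b : nat -> bool), uniq s ->
    prb Pr [set w | forall k, k \in s -> B k w = b k] =
    \prod_(k <- s) prb Pr [set w | B k w = b k] }.

(* [Pr i] is the law under which the chain starts in [i]; all these laws live on
   one sample space, which is no restriction. *)
Record geometric_observation (R : realType) (n : nat) (P : 'M[R]_n) (q : R)
    (d : measure_display) (Omega : measurableType d)
    (Pr : 'I_n -> probability Omega R)
    (X : nat -> Omega -> 'I_n) (B : nat -> Omega -> bool) : Prop :=
  GeometricObservation {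
  obs_chain : forall i, markov_chain P i (Pr i) X;
  obs_trials : forall i, bernoulli_trials q (Pr i) B;
  obs_indep : forall i, independent_processes (Pr i) X B }.

(* [first_success b k] says that the epoch of observation is [k]; when [b] has
   no success (a null event for Bernoulli trials), no [k] qualifies. *)
Definition first_success (b : nat -> bool) (k : nat) : Prop :=
  b k = true /\ forall l : nat, (l < k)%N -> b l = false.

Definition observed_in (Omega : Type) (n : nat) (X : nat -> Omega -> 'I_n)
    (B : nat -> Omega -> bool) (j : 'I_n) : set Omega :=
  [set w | exists k : nat, first_success (fun l => B l w) k /\ X k w = j].

Definition obs_transition (R : realType) (n : nat) (d : measure_display)
    (Omega : measurableType d) (Pr : 'I_n -> probability Omega R)
    (X : nat -> Omega -> 'I_n) (B : nat -> Omega -> bool) : 'M[R]_n :=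
  \matrix_(i < n, j < n) prb (Pr i) (observed_in X B j).

Lemma weight_ge0 (R : realType) (n : nat) (G : wdigraph R n) i j :
  0 <= weight G i j.
Proof.
have [/weight_gt0/ltW//|/weight_eq0 ->//] := boolP (arc G i j).
Qed.

Lemma kirchhoff_mulE (R : realType) (n : nat) (G : wdigraph R n)
    (v : 'I_n -> R) i :
  \sum_(j < n) kirchhoff G i j * v j =
  \sum_(k < n | k != i) weight G k i * (v i - v k).
Proof.
rewrite (bigD1 i) //= mxE eqxx sumrN opprK mulr_suml -big_split /=.
apply: eq_bigr => k ki; rewrite mxE eq_sym (negPf ki) /kirchhoff_offdiag.
by rewrite mulrBr mulNr.
Qed.

Lemma out_forest_unitmx (R : realType) (n : nat) (G : wdigraph R n) (tau : R) :
  0 <= tau -> 1%:M + tau *: kirchhoff G \in unitmx.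
Proof.
move=> tau0; set A := _ + _.
have AE (v : 'rV[R]_n) i : (v *m A^T) 0 i =
    v 0 i + tau * \sum_(k < n | k != i) weight G k i * (v 0 i - v 0 k).
  rewrite -(kirchhoff_mulE G (fun k => v 0 k)) !mxE mulr_sumr.
  have -> : v 0 i = \sum_j (i == j)%:R * v 0 j.
    rewrite (bigD1 i) //= eqxx mul1r big1 ?addr0 // => j ji.
    by rewrite eq_sym (negPf ji) mul0r.
  rewrite -big_split /=; apply: eq_bigr => j _.
  by rewrite !mxE mulrC mulrDl mulrA.
have le0 (v : 'rV[R]_n) : v *m A^T = 0 -> forall i, v 0 i <= 0.
  move=> vA i.
  pose m := [arg max_(k > i) v 0 k]%O.
  have mP k : v 0 k <= v 0 m.
    by rewrite /m; case: arg_maxP => // a _; apply.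
  apply: le_trans (mP i) _.
  have /eqP := AE v m; rewrite vA mxE eq_sym addr_eq0 => /eqP ->.
  rewrite oppr_le0 mulr_ge0 // sumr_ge0 // => k _.
  by rewrite mulr_ge0 ?weight_ge0 // subr_ge0.
rewrite -unitmx_tr -row_free_unit; apply/inj_row_free => v vA.
apply/rowP => i; rewrite mxE; apply/le_anti; rewrite le0 //=.
have := le0 (- v); rewrite mulNmx vA oppr0 => /(_ erefl i).
by rewrite mxE oppr_le0.
Qed.

(* Main.v *)
(** With success probability [q], the epoch of observation is [k] with
    probability [(1 - q)^k q] independently of the chain, so the observed
    transition matrix is the entrywise limit of [\sum_(k < m) (1 - q)^k q P^k].
    The value of [q] is the one for which [1 - (1 - q) P = q (1 + tau L)]; hence
    this partial sum is [Q - (1 - q)^m P^m Q] with [Q = (1 + tau L)^-1], and the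
    error term tends to [0] because the entries of [P^m], being probabilities,
    are bounded. *)

Require Import Defs.
From mathcomp Require Import all_boot all_order all_algebra.
From mathcomp Require Import all_classical all_reals all_analysis.
From mathcomp Require Import ring lra.
Set Implicit Arguments.
Unset Strict Implicit.
Unset Printing Implicit Defensive.
Import Order.TTheory GRing.Theory Num.Theory.
Import numFieldNormedType.Exports.
Local Open Scope classical_set_scope.
Local Open Scope ring_scope.

(** * Sigma-algebras generated by processes *)

(** A cylinder is a countable intersection of generators. This brings the event of a first success
    at time [k] within reach of the independence hypothesis. *)
Lemma process_sigma_cylinder (Omega : pointedType) (T : Type)
    (Y : nat -> Omega -> T) (k : nat) (x : nat -> T) :
  process_sigma Y [set w | forall l, (l <= k)%N -> Y l w = x l].
Proof.
set G := [set A | exists (k : nat) (D : set T), A = Y k @^-1` D].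
have -> : [set w | forall l, (l <= k)%N -> Y l w = x l] =
    \bigcap_(l in [set l | (l <= k)%N]) (Y l @^-1` [set x l]).
  by apply/seteqP; split => w /= h l; exact: h.
apply: (@bigcap_measurable _ (g_sigma_algebraType G)); first by exists 0%N.
by move=> l _; apply: sub_sigma_algebra; exists l, [set x l].
Qed.

Lemma process_sigma_preimage (Omega T : Type) (Y : nat -> Omega -> T)
    (k : nat) (D : set T) : process_sigma Y (Y k @^-1` D).
Proof. by apply: sub_sigma_algebra; exists k, D. Qed.

Lemma process_sigma_measurable (d : measure_display)
    (Omega : measurableType d) (T : Type) (Y : nat -> Omega -> T) :
  discrete_process Y -> forall A, process_sigma Y A -> measurable A.
Proof.
move=> mY; apply: smallest_sub; first exact: sigma_algebra_measurable.
by move=> _ [k [D ->]]; exact: mY.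
Qed.

(** * Real-valued probabilities *)

Section Prb.
Context {R : realType} {d : measure_display} {Omega : measurableType d}.
Variable Pr : probability Omega R.

Lemma prbK A : measurable A -> (prb Pr A)%:E = Pr A.
Proof. by move=> mA; rewrite fineK// fin_num_measure. Qed.

Lemma prb_ge0 A : 0 <= prb Pr A.
Proof. exact: fine_ge0. Qed.

Lemma le_prb A C : measurable A -> measurable C -> A `<=` C ->
  prb Pr A <= prb Pr C.
Proof.
by move=> mA mC AC; rewrite -lee_fin !prbK//; apply: le_measure; rewrite ?inE.
Qed.

Lemma prb_le1 A : measurable A -> prb Pr A <= 1.
Proof. by move=> mA; rewrite -lee_fin prbK// probability_le1. Qed.

Lemma prb_setC A : measurable A -> prb Pr (~` A) = 1 - prb Pr A.
Proof.
move=> mA; apply: EFin_inj.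
rewrite prbK; last exact: measurableC.
by rewrite probability_setC// EFinB prbK.
Qed.

Lemma prb_partition (T : finType) (f : Omega -> T) A : measurable A ->
    (forall t, measurable (f @^-1` [set t])) ->
  prb Pr A = \sum_t prb Pr (A `&` f @^-1` [set t]).
Proof.
move=> mA mf; apply: EFin_inj; rewrite prbK// -sumEFin.
rewrite (eq_bigr (fun t => Pr (A `&` f @^-1` [set t]))); last first.
  by move=> t _; rewrite prbK//; exact: measurableI.
rewrite bigfs ?index_enum_uniq => [|//|t _]; last by rewrite mem_index_enum.
rewrite -measure_fin_bigcup; first last.
- by move=> t _; exact: measurableI.
- by move=> s t _ _ [w [[_ <-] [_ <-]]].
- exact: finite_finset.
by congr (Pr _); apply/seteqP; split => [w Aw|w [t _ []//]]; exists (f w).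
Qed.

End Prb.

(** * Law of the chain after [k] steps *)

Section MarkovChain.
Context {R : realType} {n : nat} {P : 'M[R]_n} {i : 'I_n}.
Context {d : measure_display} {Omega : measurableType d}.
Context {Pr : probability Omega R} {X : nat -> Omega -> 'I_n}.
Hypothesis chainX : markov_chain P i Pr X.

Lemma measurable_cylinder (k : nat) (x : nat -> 'I_n) :
  measurable [set w | forall l, (l <= k)%N -> X l w = x l].
Proof.
apply: (process_sigma_measurable (chain_measurable chainX)).
exact: process_sigma_cylinder.
Qed.

(** Multiplying out the conditional probability removes the side condition of [chain_step]: over a
    null past both sides vanish, the left one by monotonicity. *)
Lemma chain_cylinder_step (k : nat) (x : nat -> 'I_n) (j : 'I_n) :
  let past := [set w | forall l, (l <= k)%N -> X l w = x l] in
  prb Pr ([set w | X k.+1 w = j] `&` past) = prb Pr past * P (x k) j.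
Proof.
move=> past.
have mpast : measurable past by exact: measurable_cylinder.
have mX : measurable [set w | X k.+1 w = j].
  exact: (chain_measurable chainX k.+1 [set j]).
have [past0|pastN0] := eqVneq (prb Pr past) 0.
  rewrite past0 mul0r; apply/le_anti; rewrite prb_ge0 andbT -past0.
  by apply: le_prb => //; exact: measurableI.
by rewrite -(chain_step chainX)// /cond_prb mulrCA divff// mulr1.
Qed.

(* The step rule conditions on whole pasts, not on [X k] alone, so the
   induction step sums over all paths of length [k + 1]. *)
Lemma chain_distribution (k : nat) (j : 'I_n) :
  prb Pr [set w | X k w = j] = (P ^+ k) i j.
Proof.
have mX l m : measurable [set w | X l w = m].
  exact: (chain_measurable chainX l [set m]).
elim: k j => [|k IH] j.
  rewrite expr0 mxE; have [<-|ij] := eqVneq i j.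
    exact: (chain_start chainX).
  (* For [j] other than [i], the event lies in the complement of the almost sure event of starting
     in [i]. *)
  apply/le_anti; rewrite prb_ge0 andbT mulr0n.
  have <- : prb Pr (~` [set w | X 0%N w = i]) = 0.
    by rewrite prb_setC// (chain_start chainX) subrr.
  apply: le_prb => //; first exact: measurableC.
  by move=> w /= -> /esym/eqP; rewrite (negPf ij).
(* Packing the past into a finite type splits events into finitely many cylinders; [inord] turns a
   path back into a sequence, read only at times up to [k]. *)
pose path w : {ffun 'I_k.+1 -> 'I_n} := [ffun l : 'I_k.+1 => X l w].
have pathE t : path @^-1` [set t] =
    [set w | forall l, (l <= k)%N -> X l w = t (inord l)].
  apply/seteqP; split => w /= => [<- l lk|h]; first by rewrite ffunE inordK.
  by apply/ffunP => l; rewrite ffunE h ?inord_val// -ltnS.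
have mpath t : measurable (path @^-1` [set t]).
  by rewrite pathE; exact: (measurable_cylinder k (fun l => t (inord l))).
rewrite (prb_partition Pr _ mpath)// exprSr mxE.
under [RHS]eq_bigr => l _ do
  rewrite -IH (prb_partition Pr (mX k l) mpath) mulr_suml.
rewrite exchange_big/=; apply: eq_bigr => t _.
(* On the cylinder of [t] the state at time [k] is [t (inord k)], so every other [l] contributes the
   empty event. *)
rewrite (bigD1 (t (inord k)))//= big1 ?addr0 => [|l lt].
  rewrite pathE (chain_cylinder_step k (fun l => t (inord l)) j)/=.
  congr (prb Pr _ * _); apply/seteqP; split => [w h|w []//].
  by split => //; exact: h.
rewrite (_ : _ `&` _ = set0) ?/prb ?measure0 ?mul0r//.
apply/seteqP; split => // w [/= Xl pt].
by move: lt; rewrite -pt ffunE inordK// Xl eqxx.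
Qed.

End MarkovChain.

(** * Law of the first success *)

Section BernoulliTrials.
Context {R : realType} {q : R}.
Context {d : measure_display} {Omega : measurableType d}.
Context {Pr : probability Omega R} {B : nat -> Omega -> bool}.
Hypothesis trialsB : bernoulli_trials q Pr B.

(** As a cylinder with prescribed values [l == k], the event fits both [trials_indep] and
    [process_sigma_cylinder]. *)
Lemma first_successE (k : nat) :
  [set w | first_success (fun l => B l w) k] =
  [set w | forall l, (l <= k)%N -> B l w = (l == k)].
Proof.
apply/seteqP; split => w /= => [[Bk B0] l|h]; last first.
  split=> [|l lk]; first by rewrite h// eqxx.
  by rewrite h ?(ltn_eqF lk)// ltnW.
by rewrite leq_eqVlt; case: eqVneq => [->//|lk /= /B0].
Qed.

Lemma prb_first_success (k : nat) :
  prb Pr [set w | first_success (fun l => B l w) k] = (1 - q) ^+ k * q.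
Proof.
have BE b l : prb Pr [set w | B l w = b] = if b then q else 1 - q.
  case: b; first exact: (trials_success trialsB).
  rewrite -(trials_success trialsB l) -prb_setC.
    by congr prb; apply/seteqP; split => w /=; case: (B l w).
  exact: (trials_measurable trialsB l [set true]).
rewrite first_successE.
have -> : [set w | forall l, (l <= k)%N -> B l w = (l == k)] =
    [set w | forall l, l \in index_iota 0 k.+1 -> B l w = (l == k)].
  by apply/seteqP; split => w /= h l; have := h l; rewrite mem_index_iota.
rewrite (trials_indep trialsB (fun l => l == k)) ?iota_uniq//.
(* The last factor, at time [k], is the success; the [k] earlier ones are failures. *)
rewrite big_nat_recr//= BE eqxx; congr (_ * _).
rewrite (eq_big_nat _ _ (F2 := fun=> 1 - q)).
  by rewrite prodr_const_nat subn0.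
by move=> l /andP[_ lk]; rewrite BE (ltn_eqF lk).
Qed.

End BernoulliTrials.

(** * The observed transition matrix as a series *)

Section GeometricObservation.
Context {R : realType} {n : nat} {P : 'M[R]_n} {q : R}.
Context {d : measure_display} {Omega : measurableType d}.
Context {Pr : 'I_n -> probability Omega R}.
Context {X : nat -> Omega -> 'I_n} {B : nat -> Omega -> bool}.
Hypothesis obs : geometric_observation P q Pr X B.

Lemma obs_transition_series (i j : 'I_n) :
  \sum_(0 <= k < m) (1 - q) ^+ k * q * (P ^+ k) i j @[m --> \oo] -->
  obs_transition Pr X B i j.
Proof.
have chainX := obs_chain obs i; have trialsB := obs_trials obs i.
pose F k := [set w | X k w = j] `&` [set w | first_success (B ^~ w) k].
have sX k : process_sigma X [set w | X k w = j].
  exact: (@process_sigma_preimage _ _ X k [set j]).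
have sB k : process_sigma B [set w | first_success (B ^~ w) k].
  rewrite first_successE.
  exact: (@process_sigma_cylinder _ _ B k (fun l => l == k)).
have mF k : measurable (F k).
  apply: measurableI.
    exact: (process_sigma_measurable (chain_measurable chainX) (sX k)).
  exact: (process_sigma_measurable (trials_measurable trialsB) (sB k)).
have obsE : observed_in X B j = \bigcup_k F k.
  by apply/seteqP; split => [w [k []]|w [k _ []]]; exists k.
have FE k : prb (Pr i) (F k) = (1 - q) ^+ k * q * (P ^+ k) i j.
  rewrite (obs_indep obs i (sX k) (sB k)) (chain_distribution chainX).
  by rewrite (prb_first_success trialsB) mulrC.
(* Epochs are unique: for two distinct ones, the trial at the earlier would be both a success and a
   failure. *)
have tF : trivIset setT F.
  move=> k l _ _ [w [[_ [Bk k0]] [_ [Bl l0]]]].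
  by case: (ltngtP k l) => // [/l0|/k0]; rewrite ?Bk ?Bl.
have mU : measurable (\bigcup_k F k) by exact: bigcup_measurable.
(* Countable additivity gives convergence in the extended reals; the limit is finite, so [fine_cvg]
   carries it to the reals. *)
have /= := @measure_semi_sigma_additive _ _ _ (Pr i) F mF tF mU.
rewrite -prbK// -obsE mxE => /fine_cvg.
apply: cvg_trans; apply: near_eq_cvg; near=> m => /=.
rewrite -(eq_bigr _ (fun k _ => prbK _ (mF k))) sumEFin/=.
by apply: eq_bigr => k _; rewrite FE.
Unshelve. all: by end_near. Qed.

End GeometricObservation.

(** * Geometric sums of matrices and their limit *)

Lemma mulmx_geometric_sum {R : pzRingType} {n : nat} (A : 'M[R]_n) (m : nat) :
  (\sum_(0 <= k < m) A ^+ k) *m (1%:M - A) = 1%:M - A ^+ m.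
Proof.
rewrite -[LHS]/(_ * (1 - A)) mulr_suml.
rewrite (eq_bigr (fun k => - (A ^+ k.+1 - A ^+ k))).
  by rewrite sumrN telescope_sumr// opprB.
by move=> k _; rewrite mulrBr mulr1 -exprSr opprB.
Qed.

Lemma exprmxZ {R : comPzRingType} {n : nat} (a : R) (A : 'M[R]_n) (k : nat) :
  (a *: A) ^+ k = a ^+ k *: A ^+ k.
Proof.
elim: k => [|k IH]; first by rewrite !expr0 scale1r.
by rewrite !exprS IH -[LHS]/(_ *m _) -scalemxAl -scalemxAr scalerA.
Qed.

Theorem theorem6 (R : realType) (n : nat) (G : wdigraph R n)
    (tau alpha q : R) (P : 'M[R]_n)
    (d : measure_display) (Omega : measurableType d)
    (Pr : 'I_n -> probability Omega R)
    (X : nat -> Omega -> 'I_n) (B : nat -> Omega -> bool)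
    (n_gt1 : (1 < n)%N) (tau_gt0 : 0 < tau) (alpha_gt0 : 0 < alpha)
    (P_stoch : row_stochastic P)
    (P_related : P = 1%:M - alpha *: kirchhoff G)
    (q_def : q = (tau / alpha + 1)^-1)
    (obs : geometric_observation P q Pr X B) :
  out_forest G tau = obs_transition Pr X B.
Proof.
have s_gt0 : 0 < tau + alpha by rewrite addr_gt0.
have qE : q = alpha / (tau + alpha) by rewrite q_def; field; lra.
have rE : 1 - q = tau / (tau + alpha) by rewrite qE; field; lra.
have q_gt0 : 0 < q by rewrite qE divr_gt0.
have r_ge0 : 0 <= 1 - q by rewrite rE ltW// divr_gt0.
set r := 1 - q in rE r_ge0.
set M := 1%:M + tau *: kirchhoff G.
have Munit : M \in unitmx by rewrite out_forest_unitmx// ltW.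
(* The choice of [q] enters through [1 - r = q] and [r * alpha = q * tau]. *)
have rPE : 1%:M - r *: P = q *: M.
  apply/matrixP => i j; rewrite P_related !mxE rE qE; field; lra.
have partial m : \sum_(0 <= k < m) (r ^+ k * q) *: P ^+ k =
    out_forest G tau - r ^+ m *: (P ^+ m *m out_forest G tau).
  have := mulmx_geometric_sum (r *: P) m.
  rewrite rPE -scalemxAr scalemxAl => /(congr1 (mulmx^~ (invmx M))).
  rewrite -mulmxA mulmxV// mulmx1 mulmxBl mul1mx exprmxZ -scalemxAl => <-.
  by rewrite scaler_sumr; apply: eq_bigr => k _; rewrite exprmxZ scalerA mulrC.
apply/matrixP => i j.
suff QP : \sum_(0 <= k < m) r ^+ k * q * (P ^+ k) i j @[m --> \oo] -->
    out_forest G tau i j.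
  exact: norm_cvg_unique QP (obs_transition_series obs (i:=i) (j:=j)).
have PE k l : (P ^+ k) i l = prb (Pr i) [set w | X k w = l].
  by rewrite (chain_distribution (obs_chain obs i)).
(* A bound uniform in [m]: by [PE], the entries of [P ^+ m] in row [i] lie between 0 and 1. *)
pose C := \sum_l `|out_forest G tau l j|.
have bound m : `|(P ^+ m *m out_forest G tau) i j| <= C.
  rewrite mxE (le_trans (ler_norm_sum _ _ _))// ler_sum// => l _.
  rewrite normrM ler_piMl// PE ger0_norm ?prb_ge0// prb_le1//.
  exact: (chain_measurable (obs_chain obs i) m [set l]).
have r_to0 : r ^+ m * C @[m --> \oo] --> 0.
  rewrite -[0](mul0r C); apply: cvgMl; apply: cvg_expr.
  by rewrite ger0_norm// ltrBlDr ltrDl.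
have err_to0 : r ^+ m * (P ^+ m *m out_forest G tau) i j @[m --> \oo] --> 0.
  apply: norm_cvg0; apply: (squeeze_cvgr _ (cvg_cst 0) r_to0).
  near=> m; rewrite normr_ge0 normrM ger0_norm ?exprn_ge0//.
  by rewrite ler_wpM2l ?exprn_ge0.
rewrite (_ : (fun m => _) = fun m => out_forest G tau i j -
    r ^+ m * (P ^+ m *m out_forest G tau) i j).
  by rewrite -[X in _ --> X]subr0; apply: cvgB => //; exact: cvg_cst.
apply/funext => m; have /matrixP/(_ i j) := partial m.
by rewrite summxE !mxE => <-; apply: eq_bigr => k _; rewrite mxE.
Unshelve. all: by end_near. Qed.
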